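(* Let $S=\mathbb{N}A$ and let $$S=S_c\setminus\bigcup_{i=1}^m(\mathbf{b}_i+\mathbb{Z}(A\cap\tau_i))$$ be its standard expression. Assume that $\operatorname{codim}\tau_m>1$ and that $$\Bigl(\bigcap_{\tau_i\succ\tau_m,\ \mathbf{b}_i-\mathbf{b}_m\in K\tau_i}\tau_i\Bigr)\neq\tau_m .$$ Then $D(S)$ is not left Noetherian.
   Context: $K$ is an algebraically closed field of characteristic zero. $A\subset\mathbb{Z}^d$ is a finite set with $\mathbb{Z}A=\mathbb{Z}^d$ and with strongly convex cone $\mathbb{R}_{\geq 0}A$; $\mathbb{N}A$ is the monoid generated by $A$. For a facet $\sigma$ of $\mathbb{R}_{\geq 0}A$, $F_\sigma$ is the unique linear form on $\mathbb{R}^d$ with $F_\sigma(\mathbb{R}_{\geq 0}A)\geq 0$, $F_\sigma(\sigma)=0$, $F_\sigma(\mathbb{Z}^d)=\mathbb{Z}$. For a face $\tau$, $\mathbb{Z}(A\cap\tau)$ is the group generated by $A\cap\tau$ (it is $0$ if $\tau=\{\mathbf{0}\}$), and $K\tau\subseteq K^d$ is the $K$-linear span of $A\cap\tau$. $\tau_i\succ\tau_m$ means that $\tau_m$ is a face of $\tau_i$ and $\tau_i\neq\tau_m$. An intersection of faces over an empty index set is understood to be $\mathbb{R}_{\geq 0}A$. $S_c=\{\mathbf{a}\in\mathbb{Z}^d: F_\sigma(\mathbf{a})\in F_\sigma(\mathbb{N}A)\text{ for all facets }\sigma\}$ is the scored closure of $\mathbb{N}A$. A standard expression is one of the displayed form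 with $\mathbf{b}_i\in S_c$ and $\tau_i$ faces of $\mathbb{R}_{\geq0}A$ which is irredundant (none of the sets $\mathbf{b}_i+\mathbb{Z}(A\cap\tau_i)$ can be omitted); the collection of sets $\mathbf{b}_i+\mathbb{Z}(A\cap\tau_i)$ is then unique. $D(\mathbb{Z}^d)=K[t_1^{\pm1},\ldots,t_d^{\pm1}]\langle\partial_1,\ldots,\partial_d\rangle$ acts on $K[t_1^{\pm1},\ldots,t_d^{\pm1}]$. For $T\subseteq\mathbb{Z}^d$, $K[T]=\bigoplus_{\mathbf{a}\in T}Kt^{\mathbf{a}}$ and $D(T)=\{P\in D(\mathbb{Z}^d):P(K[T])\subseteq K[T]\}$. ($D(\mathbb{N}A)$ is Grothendieck's ring of differential operators of the semigroup algebra $K[\mathbb{N}A]$.) *)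

(* Defs.v *)
Set Warnings "-all".
From HB Require Import structures.
From mathcomp Require Import all_boot all_order all_algebra finmap.
From mathcomp Require Import all_classical reals.
From mathcomp Require Import monalg.

Set Implicit Arguments.
Unset Strict Implicit.
Unset Printing Implicit Defensive.

Import Order.TTheory GRing.Theory Num.Theory.

Local Open Scope classical_set_scope.
Local Open Scope ring_scope.

Section LeftNoetherian.
Variable T : pzRingType.

Definition left_ideal (I : set T) : Prop :=
  [/\ I 0, forall x y, I x -> I y -> I (x + y) & forall r x, I x -> I (r * x)].

Definition left_noetherian : Prop :=
  forall I : nat -> set T,
    (forall n, left_ideal (I n)) -> (forall n, I n `<=` I n.+1) ->
    exists N, forall n, (N <= n)%N -> I n = I N.

End LeftNoetherian.

(* The ring of linear endomorphisms of a module of arbitrary dimension,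
   with composition as multiplication. *)
Section LinearEndomorphisms.
Variables (K : comNzRingType) (V : lmodType K).

Definition lend : Type := {linear V -> V}.

Definition lend_fun (P : lend) : V -> V := (P : {linear V -> V}).

HB.instance Definition _ := gen_eqMixin lend.
HB.instance Definition _ := gen_choiceMixin lend.

Lemma lendP (P Q : lend) : lend_fun P =1 lend_fun Q -> P = Q.
Proof.
case: P Q => [f cf] [g cg] /funext fg.
have {}fg : f = g by exact: fg.
subst g; congr (GRing.Linear.Pack _).
case: cf cg => [[p1] [p2]] [[q1] [q2]].
by rewrite (Prop_irrelevance p1 q1) (Prop_irrelevance p2 q2).
Qed.

Definition lend_zero : lend := (\0 : {linear V -> V}).
Definition lend_add (P Q : lend) : lend :=
  ((P : {linear V -> V}) \+ (Q : {linear V -> V}) : {linear V -> V}).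
Definition lend_opp (P : lend) : lend :=
  (\- (P : {linear V -> V}) : {linear V -> V}).
Definition lend_one : lend := (idfun : {linear V -> V}).
Definition lend_mul (P Q : lend) : lend :=
  ((P : {linear V -> V}) \o (Q : {linear V -> V}) : {linear V -> V}).

Fact lend_addA : associative lend_add.
Proof. by move=> P Q U; apply: lendP => v; exact: addrA. Qed.
Fact lend_addC : commutative lend_add.
Proof. by move=> P Q; apply: lendP => v; exact: addrC. Qed.
Fact lend_add0 : left_id lend_zero lend_add.
Proof. by move=> P; apply: lendP => v; exact: add0r. Qed.
Fact lend_addN : left_inverse lend_zero lend_opp lend_add.
Proof. by move=> P; apply: lendP => v; exact: addNr. Qed.

HB.instance Definition _ :=
  GRing.isZmodule.Build lend lend_addA lend_addC lend_add0 lend_addN.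

Fact lend_mulA : associative lend_mul.
Proof. by move=> P Q U; exact: lendP. Qed.
Fact lend_mul1l : left_id lend_one lend_mul.
Proof. by move=> P; exact: lendP. Qed.
Fact lend_mul1r : right_id lend_one lend_mul.
Proof. by move=> P; exact: lendP. Qed.
Fact lend_mulDl : left_distributive lend_mul +%R.
Proof. by move=> P Q U; exact: lendP. Qed.
Fact lend_mulDr : right_distributive lend_mul +%R.
Proof. by move=> P Q U; apply: lendP => v; exact: linearD. Qed.

HB.instance Definition _ := GRing.Zmodule_isPzRing.Build lend
  lend_mulA lend_mul1l lend_mul1r lend_mulDl lend_mulDr.

End LinearEndomorphisms.

Section LaurentOperators.
Variables (K : fieldType) (d : nat).

(* [{malg K['rV[int]_d]}] is the free K-module on the exponents Z^d, here the
   module of Laurent polynomials in d variables; [<< a >>] is the monomial t^a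
   and [f@_a] the coefficient of t^a in f. *)
Definition laurent : Type := {malg K['rV[int]_d]}.
HB.instance Definition _ := GRing.Lmodule.on laurent.

Definition monomial (a : 'rV[int]_d) : laurent := << 1 *g a >>.

Definition extend_linearly (phi : 'rV[int]_d -> laurent) (f : laurent)
    : laurent :=
  \sum_(a <- msupp f) f@_a *: phi a.

Lemma extend_linearlyEw phi (f : laurent) (D : {fset 'rV[int]_d}) :
  (msupp f `<=` D)%fset ->
  extend_linearly phi f = \sum_(a <- D) f@_a *: phi a.
Proof.
move=> fD; apply: big_fset_incl => // a _ /mcoeff_outdom ->.
by rewrite scale0r.
Qed.

Fact extend_linearly_is_linear phi : linear (extend_linearly phi).
Proof.
move=> c f g.
pose D := (msupp f `|` msupp g `|` msupp (c *: f + g))%fset.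
have sf : (msupp f `<=` D)%fset.
  by apply/fsubsetP => a af; rewrite !inE af.
have sg : (msupp g `<=` D)%fset.
  by apply/fsubsetP => a ag; rewrite !inE ag orbT.
have sfg : (msupp (c *: f + g) `<=` D)%fset.
  by apply/fsubsetP => a afg; rewrite !inE afg orbT.
rewrite (extend_linearlyEw _ sf) (extend_linearlyEw _ sg).
rewrite (extend_linearlyEw _ sfg) scaler_sumr -big_split /=.
by apply: eq_bigr => a _; rewrite mcoeffD mcoeffZ scalerDl scalerA.
Qed.

HB.instance Definition _ phi := GRing.isLinear.Build K laurent laurent *:%R
  (extend_linearly phi) (extend_linearly_is_linear phi).

Lemma extend_linearlyE phi a : extend_linearly phi (monomial a) = phi a.
Proof.
rewrite (extend_linearlyEw _ (@msuppU_le _ _ a 1)) big_seq_fset1.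
by rewrite mcoeffUU scale1r.
Qed.

Definition monomial_op (b : 'rV[int]_d) : lend laurent :=
  (extend_linearly (fun a => monomial (b + a))
     : {linear laurent -> laurent}).

Definition partial_op (i : 'I_d) : lend laurent :=
  (extend_linearly (fun a => (a 0 i)%:~R *: monomial (a - delta_mx 0 i))
     : {linear laurent -> laurent}).

Definition scalar_op (c : K) : lend laurent :=
  (( *:%R c) : {linear laurent -> laurent}).

(* The algebra generated by K, the t_i^{+1}, t_i^{-1} and the d/dt_i. In
   characteristic 0 the Weyl algebra localized at the t_i acts faithfully on
   Laurent polynomials, so it is this subring of the endomorphism ring. *)
Inductive diffop_torus : lend laurent -> Prop :=
| diffop_scalar c : diffop_torus (scalar_op c)
| diffop_var i : diffop_torus (monomial_op (delta_mx 0 i))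
| diffop_varV i : diffop_torus (monomial_op (- delta_mx 0 i))
| diffop_partial i : diffop_torus (partial_op i)
| diffop_add P Q : diffop_torus P -> diffop_torus Q -> diffop_torus (P + Q)
| diffop_mul P Q : diffop_torus P -> diffop_torus Q -> diffop_torus (P * Q).

Definition laurent_on (T : set 'rV[int]_d) : set laurent :=
  [set f | forall a, a \in msupp f -> T a].

Definition diffop_pred (T : set 'rV[int]_d) : {pred lend laurent} :=
  fun P => `[< diffop_torus P /\
               forall f, laurent_on T f -> laurent_on T (lend_fun P f) >].

Fact diffop_subring (T : set 'rV[int]_d) : subring_closed (diffop_pred T).
Proof.
have oneE : 1 = scalar_op 1.
  by apply: lendP => f; rewrite /lend_fun /= scale1r.
have N1E (P : lend laurent) : - P = scalar_op (-1) * P.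
  by apply: lendP => f; rewrite /lend_fun /= scaleN1r.
split=> [|P Q /asboolP[DP TP] /asboolP[DQ TQ]|P Q /asboolP[DP TP] /asboolP[DQ TQ]].
- by apply/asboolP; split=> //; rewrite oneE; exact: diffop_scalar.
- apply/asboolP; split.
    apply: diffop_add => //; rewrite N1E; apply: diffop_mul => //.
    exact: diffop_scalar.
  move=> f Tf a /=; rewrite /lend_fun /= => /(fsubsetP (msuppB_le _ _)).
  by rewrite in_fsetU => /orP[/(TP _ Tf)|/(TQ _ Tf)].
- apply/asboolP; split; first exact: diffop_mul.
  by move=> f Tf; apply: TP; exact: TQ.
Qed.

HB.instance Definition _ T :=
  GRing.isSubringClosed.Build (lend laurent) (diffop_pred T) (diffop_subring T).

(* D(T) *)
Record diffop_ring (T : set 'rV[int]_d) := DiffOp {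
  diffop_val :> lend laurent;
  _ : diffop_pred T diffop_val
}.

HB.instance Definition _ T := [isSub for @diffop_val T].
HB.instance Definition _ T := [Choice of diffop_ring T by <:].
HB.instance Definition _ T := GRing.SubChoice_isSubPzRing.Build
  (lend laurent) (diffop_pred T) (diffop_ring T) (diffop_subring T).

End LaurentOperators.

Section Cones.
Variables (R : realType) (d : nat).
Implicit Types (C tau sigma : set 'rV[R]_d) (A : {fset 'rV[int]_d}).

Definition int_vec (L : pzRingType) (a : 'rV[int]_d) : 'rV[L]_d :=
  map_mx intr a.

Definition cone A : set 'rV[R]_d :=
  [set v | exists2 c : 'rV[int]_d -> R, forall a, 0 <= c a &
     v = \sum_(a <- A) c a *: int_vec R a].

Definition strongly_convex C : Prop := forall v, C v -> C (- v) -> v = 0.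

(* Every face is cut out by a supporting linear form; the zero form is allowed,
   so C is a face of itself. *)
Definition face_of C tau : Prop :=
  exists2 F : {scalar 'rV[R]_d}, forall v, C v -> 0 <= F v &
    tau = [set v | C v /\ F v = 0].

(* Dimension of the linear span: the maximal number of linearly independent
   vectors. *)
Definition dim C : nat :=
  \max_(k < d.+1 | `[< exists B : k.-tuple 'rV[R]_d,
                        free B /\ forall v, v \in B -> C v >]) k.

Definition codim C : nat := (d - dim C)%N.

Definition facet_of C sigma : Prop :=
  face_of C sigma /\ (dim sigma).+1 = dim C.

(* [F] is the primitive integral support function F_sigma of the facet
   [sigma] of the cone of [A]. *)
Definition primitive_form A sigma (F : {scalar 'rV[R]_d}) : Prop :=
  [/\ forall v, cone A v -> 0 <= F v,
      forall v, sigma v -> F v = 0 &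
      [set F (int_vec R a) | a in [set: 'rV[int]_d]] = [set k%:~R | k in [set: int]]].

Definition monoid_gen A : set 'rV[int]_d :=
  [set x | exists c : 'rV[int]_d -> nat, x = \sum_(a <- A) a *+ c a].

(* Z(A \cap tau) *)
Definition group_gen A tau : set 'rV[int]_d :=
  [set x | exists c : 'rV[int]_d -> int,
     x = \sum_(a <- A | `[< tau (int_vec R a) >]) a *~ c a].

(* K tau *)
Definition span_over (K : fieldType) A tau : {vspace 'rV[K]_d} :=
  <<[seq int_vec K a | a <- A & `[< tau (int_vec R a) >]]>>%VS.

Definition scored_closure A : set 'rV[int]_d :=
  [set a | forall sigma (F : {scalar 'rV[R]_d}),
     facet_of (cone A) sigma -> primitive_form A sigma F ->
     exists2 s, monoid_gen A s & F (int_vec R a) = F (int_vec R s)].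

(* b + Z(A \cap tau) *)
Definition group_coset A (b : 'rV[int]_d) tau : set 'rV[int]_d :=
  [set b + x | x in group_gen A tau].

Definition standard_expression A (m : nat)
    (b : 'I_m -> 'rV[int]_d) (tau : 'I_m -> set 'rV[R]_d) : Prop :=
  [/\ forall i, scored_closure A (b i),
      forall i, face_of (cone A) (tau i),
      monoid_gen A =
        scored_closure A `\` \bigcup_i group_coset A (b i) (tau i) &
      forall j, monoid_gen A <>
        scored_closure A `\`
          \bigcup_(i in [set i | i != j]) group_coset A (b i) (tau i)].

End Cones.

Arguments cone R {d} A.
Arguments scored_closure R {d} A.

(* Main.v *)
Require Import Defs.
Set Warnings "-all".
From mathcomp Require Import all_boot all_order all_algebra finmap.
From mathcomp Require Import all_classical reals.
From mathcomp Require Import monalg ring zify.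

(** Write S for the monoid [monoid_gen A], S_c for its scored closure, tau for
the distinguished face tau_m and t^x for the monomial of exponent x. An
operator of degree e has the form t^e f(theta), where f is a polynomial in the
Euler operators theta_j = t_j d/dt_j, and sends t^x to f(x) t^(x+e). It lies in
D(S) exactly when f vanishes on the set of all x in S with x + e outside S.

Suppose that p is not in S, that w is a direction with p + n w in S for every
n >= 1, and that g is a polynomial. The sets

  I_k = { P G in D(S) : P in D(Z^d), P(t^(p + j w)) in K[S] for all j >= k },

with G = g(theta), form an increasing chain of left ideals of D(S), because
left multiplication by D(S) preserves K[S]. To see that I_(N+1) is strictly
larger than I_N, take X = t^(- N w) f(theta) with f(p + N w) != 0: it sends
t^(p + j w) into K[S] for j > N, but t^(p + N w) to a nonzero multiple of t^p.
Two conditions are needed. First, X G must lie in D(S): the product f g has to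
vanish at every x in S with x - N w outside S. Secondly, X must be determined
by X G, and G may well kill all the t^(p + j w). Cancellation still holds
because an element of D(Z^d) depends polynomially on the exponent it acts on:
if it kills t^(c + s u) for all s >= 1, it kills t^c
([diffop_eq0_on_line]). This gives the criterion
[not_left_noetherian_of_ray], in which the existence of f says that p + N w is
outside the Zariski closure ([separated]) of the part of
{x in S : x - N w notin S} where g does not vanish.

It remains to choose p, w and g. By irredundancy some point of S_c lies in
b_m + Z(A cap tau) and in no other coset; translating it along the interior of
tau gives p. Take w to be a multiple of an element of A that lies in all the
faces tau_i of the hypothesis on the intersection, but not in tau. As
codim tau > 1, there is a nonzero linear form that vanishes on tau and on w,
and g is this form minus its value at p. A point x of S with x - N w outside S
is of one of four kinds.

- x - N w is outside S_c. Then one of the finitely many facet forms F takes at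
  x one of finitely many values, all different from F(p + N w), because F(S)
  has finite complement in the natural numbers ([separated_scored]).
- x - N w lies in b_i + Z(A cap tau_i), and some linear form vanishing on
  A cap tau_i separates p from b_i. Then this form takes on all such x a value
  which it does not take at p + N w.
- x - N w lies in such a coset with w in tau_i. Then x lies in the same coset,
  which is impossible for x in S.
- x - N w lies in such a coset with tau_i = tau, and no form separates p from
  b_i. Then g(x) = 0.

The position of p ensures that every i falls under one of the last three
cases. *)

Set Implicit Arguments.
Unset Strict Implicit.
Unset Printing Implicit Defensive.

Import Order.TTheory GRing.Theory Num.Theory.

Local Open Scope classical_set_scope.
Local Open Scope ring_scope.

(** * Operators on Laurent polynomials *)

Section Operators.
Variables (K : fieldType) (d : nat).
Implicit Types (P Q : lend (laurent K d)) (f g : laurent K d).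
Implicit Types (a c u : 'rV[int]_d).

Local Notation mono := (@monomial K d).

Lemma lend_funD P f g : lend_fun P (f + g) = lend_fun P f + lend_fun P g.
Proof. exact: linearD. Qed.

Lemma lend_funZ P k f : lend_fun P (k *: f) = k *: lend_fun P f.
Proof. exact: linearZ. Qed.

Lemma lend_fun_sum P (I : Type) (r : seq I) (F : I -> laurent K d) :
  lend_fun P (\sum_(i <- r) F i) = \sum_(i <- r) lend_fun P (F i).
Proof. exact: linear_sum. Qed.

Lemma laurent_expand f : f = \sum_(a <- msupp f) f@_a *: mono a.
Proof.
rewrite {1}[f]monalgE; apply: eq_bigr => a _.
by apply/malgP => e; rewrite mcoeffZ !mcoeffU mulrnAr mulr1.
Qed.

Lemma lend_eq_mono P Q :
  (forall a, lend_fun P (mono a) = lend_fun Q (mono a)) -> P = Q.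
Proof.
move=> PQ; apply: lendP => f; rewrite [f]laurent_expand !lend_fun_sum.
by apply: eq_bigr => a _; rewrite !lend_funZ PQ.
Qed.

Lemma monomial_opE u a : lend_fun (monomial_op K u) (mono a) = mono (u + a).
Proof. exact: extend_linearlyE. Qed.

Lemma monomial_opD u v :
  monomial_op K (u + v) = monomial_op K u * monomial_op K v.
Proof.
apply: lend_eq_mono => a.
by rewrite /GRing.mul /= /lend_fun /= -!/(lend_fun _ _) !monomial_opE addrA.
Qed.

Lemma monomial_op0 : monomial_op K (0 : 'rV[int]_d) = 1.
Proof. by apply: lend_eq_mono => a; rewrite monomial_opE add0r. Qed.

Lemma partial_opE (i : 'I_d) a :
  lend_fun (partial_op K i) (mono a) = (a 0 i)%:~R *: mono (a - delta_mx 0 i).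
Proof. exact: extend_linearlyE. Qed.

Lemma scalar_opE k f : lend_fun (scalar_op d k) f = k *: f.
Proof. by []. Qed.

Lemma lend_funM P Q f : lend_fun (P * Q) f = lend_fun P (lend_fun Q f).
Proof. by []. Qed.

Lemma lend_fun_addl P Q f : lend_fun (P + Q) f = lend_fun P f + lend_fun Q f.
Proof. by []. Qed.

Lemma diffop1 : diffop_torus (1 : lend (laurent K d)).
Proof.
have -> : 1 = scalar_op d (1 : K).
  by apply: lendP => f; rewrite /lend_fun /= scale1r.
exact: diffop_scalar.
Qed.

Lemma diffop0 : diffop_torus (0 : lend (laurent K d)).
Proof.
have -> : 0 = scalar_op d (0 : K).
  by apply: lendP => f; rewrite /lend_fun /= scale0r.
exact: diffop_scalar.
Qed.

Lemma diffop_sum (I : Type) (r : seq I) (F : I -> lend (laurent K d)) :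
  (forall i, diffop_torus (F i)) -> diffop_torus (\sum_(i <- r) F i).
Proof.
move=> dF; elim/big_ind: _ => //; [exact: diffop0|exact: diffop_add].
Qed.

Lemma diffop_monomial u : diffop_torus (monomial_op K u).
Proof.
have dMn (v : 'rV[int]_d) n : diffop_torus (monomial_op K v) ->
    diffop_torus (monomial_op K (v *+ n)).
  move=> dv; elim: n => [|n IH]; first by rewrite mulr0n monomial_op0; exact: diffop1.
  by rewrite mulrS monomial_opD; exact: diffop_mul.
rewrite [u]row_sum_delta.
elim/big_ind: _.
- by rewrite monomial_op0; exact: diffop1.
- by move=> v w dv dw; rewrite monomial_opD; exact: diffop_mul.
move=> i _; have -> : u 0 i *: delta_mx 0 i = (delta_mx 0 i : 'rV[int]_d) *~ u 0 i.
  by rewrite -scaler_int intz.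
case: (u 0 i) => n; first by rewrite -pmulrn; apply: dMn; exact: diffop_var.
by rewrite NegzE mulrNz -mulNrz -pmulrn; apply: dMn; exact: diffop_varV.
Qed.


Section PolynomialSequences.
Variable V : lmodType K.

(** The closure rules generate the sequences that are polynomial in [s] with
coefficients in [V]; generating them inductively avoids handling coefficients. *)
Inductive poly_seq : (nat -> V) -> Prop :=
| poly_seq_const v : poly_seq (fun=> v)
| poly_seqD F G : poly_seq F -> poly_seq G -> poly_seq (fun s => F s + G s)
| poly_seqX F : poly_seq F -> poly_seq (fun s => s%:R *: F s).

End PolynomialSequences.

Lemma poly_seqZ (V : lmodType K) k (F : nat -> V) :
  poly_seq F -> poly_seq (fun s => k *: F s).
Proof.
elim=> [v|{}F G _ IF _ IG|{}F _ IF].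
- exact: poly_seq_const.
- rewrite (_ : (fun s => _) = (fun s => k *: F s + k *: G s)); first exact: poly_seqD.
  by apply/funext => s; rewrite scalerDr.
- rewrite (_ : (fun s => _) = (fun s => s%:R *: (k *: F s))); first exact: poly_seqX.
  by apply/funext => s; rewrite !scalerA mulrC.
Qed.

Lemma poly_seq_sum (V : lmodType K) (I : Type) (r : seq I) (F : I -> nat -> V) :
  (forall i, poly_seq (F i)) -> poly_seq (fun s => \sum_(i <- r) F i s).
Proof.
move=> pF; elim: r => [|i r IH].
  rewrite (_ : (fun s => _) = fun=> 0); first exact: poly_seq_const.
  by apply/funext => s; rewrite big_nil.
rewrite (_ : (fun s => _) = fun s => F i s + \sum_(i <- r) F i s).
  exact: poly_seqD.
by apply/funext => s; rewrite big_cons.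
Qed.

(** Each coefficient is the value at [s] of a polynomial over [K], which has
infinitely many roots as [K] has characteristic 0. *)
Lemma poly_seq_eq0 (F : nat -> laurent K d) : [pchar K] =i pred0 ->
  poly_seq F -> (forall s, F s.+1 = 0) -> F 0%N = 0.
Proof.
move=> /pcharf0P ch pF F0; apply/malgP => e.
have [p pE] : exists p : {poly K}, forall s, (F s)@_e = p.[s%:R].
  elim: pF => [v|{F0}F G _ [p pE] _ [q qE]|{F0}F _ [p pE]].
  - by exists (v@_e)%:P => s; rewrite hornerC.
  - by exists (p + q) => s; rewrite mcoeffD pE qE hornerD.
  - by exists ('X * p) => s; rewrite mcoeffZ pE hornerM hornerX.
rewrite pE; suff -> : p = 0 by rewrite horner0 mcoeff0.
apply: (@roots_geq_poly_eq0 _ _ [seq s.+1%:R | s <- iota 0 (size p)]).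
- by apply/allP => _ /mapP[s _ ->]; rewrite /root -pE F0 mcoeff0.
- rewrite map_inj_uniq ?iota_uniq // => s t.
  wlog st : s t / (s <= t)%N.
    by move=> W; case: (leqP s t) => [/W//|/ltnW/W] h /esym/h.
  move=> /eqP; rewrite eq_sym -subr_eq0 -natrB ?ltnS // ch subSS subn_eq0 => ts.
  by apply/eqP; rewrite eqn_leq st.
- by rewrite size_map size_iota.
Qed.

Let cj u P s := monomial_op K (- (u *+ s)) * P * monomial_op K (u *+ s).

Let cjE u P s a : lend_fun (cj u P s) (mono a) =
  lend_fun (monomial_op K (- (u *+ s))) (lend_fun P (mono (u *+ s + a))).
Proof. by rewrite /cj !lend_funM monomial_opE. Qed.

Lemma poly_seq_apply u P F :
  (forall a, poly_seq (fun s => lend_fun (cj u P s) (mono a))) ->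
  poly_seq F -> poly_seq (fun s => lend_fun (cj u P s) (F s)).
Proof.
move=> dP; elim=> [f|{}F G _ IF _ IG|{}F _ IF].
- rewrite (_ : (fun s => _) =
      fun s => \sum_(a <- msupp f) f@_a *: lend_fun (cj u P s) (mono a)).
    by apply: poly_seq_sum => a; exact: poly_seqZ.
  apply/funext => s; rewrite {1}[f]laurent_expand lend_fun_sum.
  by apply: eq_bigr => a _; rewrite lend_funZ.
- rewrite (_ : (fun s => _) =
      fun s => lend_fun (cj u P s) (F s) + lend_fun (cj u P s) (G s)).
    exact: poly_seqD.
  by apply/funext => s; rewrite lend_funD.
- rewrite (_ : (fun s => _) = fun s => s%:R *: lend_fun (cj u P s) (F s)).
    exact: poly_seqX.
  by apply/funext => s; rewrite lend_funZ.
Qed.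

(** Conjugation by the translation [s u] fixes the scalars and the monomials
and turns [d/dt_i] into [d/dt_i + s u_i / t_i], so it acts polynomially in [s] on
the generators of the ring. *)
Lemma diffop_poly_seq u P F : diffop_torus P -> poly_seq F ->
  poly_seq (fun s => lend_fun (cj u P s) (F s)).
Proof.
have mon v a : poly_seq (fun s => lend_fun (cj u (monomial_op K v) s) (mono a)).
  rewrite (_ : (fun s => _) = fun=> mono (v + a)); first exact: poly_seq_const.
  apply/funext => s; rewrite cjE !monomial_opE; congr mono.
  by rewrite addrCA addKr.
move=> dP; elim: dP F => {P} [k|i|i|i|P Q _ IP _ IQ|P Q _ IP _ IQ] F pF.
- apply: poly_seq_apply pF => a.
  rewrite (_ : (fun s => _) = fun=> k *: mono a); first exact: poly_seq_const.
  apply/funext => s; rewrite cjE scalar_opE lend_funZ.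
  by rewrite monomial_opE addKr.
- by apply: poly_seq_apply pF => a; exact: mon.
- by apply: poly_seq_apply pF => a; exact: mon.
- apply: poly_seq_apply pF => a.
  rewrite (_ : (fun s => _) = fun s => (a 0 i)%:~R *: mono (a - delta_mx 0 i)
     + s%:R *: ((u 0 i)%:~R *: mono (a - delta_mx 0 i))).
    by apply: poly_seqD; [exact: poly_seq_const|apply: poly_seqX; exact: poly_seq_const].
  apply/funext => s; rewrite cjE partial_opE lend_funZ monomial_opE.
  rewrite -[u *+ s + a - _]addrA addKr scalerA -scalerDl; congr (_ *: _).
  by rewrite !mxE mulmxnE rmorphD /= addrC rmorphMn /= mulr_natl.
- rewrite (_ : (fun s => _) =
      fun s => lend_fun (cj u P s) (F s) + lend_fun (cj u Q s) (F s)).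
    by apply: poly_seqD; [exact: IP|exact: IQ].
  by apply/funext => s; rewrite /cj mulrDr mulrDl.
- rewrite (_ : (fun s => _) =
      fun s => lend_fun (cj u P s) (lend_fun (cj u Q s) (F s))).
    by apply: IP; exact: IQ.
  apply/funext => s; rewrite -lend_funM /cj !mulrA -(mulrA _ (monomial_op K (u *+ s))).
  by rewrite -monomial_opD subrr monomial_op0 mulr1.
Qed.

(** The value at [s = 0] of a polynomial that vanishes for all [s >= 1] is 0. *)
Lemma diffop_eq0_on_line u f P : [pchar K] =i pred0 -> diffop_torus P ->
  (forall s, lend_fun P (lend_fun (monomial_op K (u *+ s.+1)) f) = 0) ->
  lend_fun P f = 0.
Proof.
move=> ch dP P0.
have := poly_seq_eq0 ch (diffop_poly_seq u dP (poly_seq_const f)).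
rewrite /cj mulr0n oppr0 monomial_op0 mulr1 mul1r; apply => s.
by rewrite !lend_funM P0; exact: (linear0 (monomial_op K _ : {linear _ -> _})).
Qed.

End Operators.

(** * Degree 0 operators and a non-Noetherianity criterion *)

Section DiagonalOperators.
Variables (K : fieldType) (d : nat).
Implicit Types (P Q : lend (laurent K d)) (f : laurent K d).
Implicit Types (a c u w p x : 'rV[int]_d) (phi psi : 'rV[int]_d -> K).
Implicit Types (S Z : set 'rV[int]_d).

Local Notation mono := (@monomial K d).

(** A [K]-linear form on [K^d], restricted to the lattice of exponents. *)
Definition lin (l : 'rV[K]_d) (c : 'rV[int]_d) : K :=
  \sum_j (c 0 j)%:~R * l 0 j.

Lemma linD l a c : lin l (a + c) = lin l a + lin l c.
Proof.
by rewrite -big_split; apply: eq_bigr => j _; rewrite !mxE rmorphD mulrDl.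
Qed.

Lemma lin0 l : lin l 0 = 0.
Proof. by apply: big1 => j _; rewrite mxE mul0r. Qed.

Lemma linN l a : lin l (- a) = - lin l a.
Proof. by apply/eqP; rewrite -addr_eq0 -linD addNr lin0. Qed.

Lemma linB l a c : lin l (a - c) = lin l a - lin l c.
Proof. by rewrite linD linN. Qed.

Lemma linMn l a n : lin l (a *+ n) = lin l a *+ n.
Proof.
by elim: n => [|n IH]; rewrite ?mulr0n ?lin0// !mulrS linD IH.
Qed.

Lemma linMz l a (z : int) : lin l (a *~ z) = lin l a *~ z.
Proof.
by case: z => n; rewrite ?NegzE ?mulrNz ?linN -?pmulrn linMn.
Qed.

Lemma lin_sum l (I : Type) (r : seq I) (Q : pred I) (F : I -> 'rV[int]_d) :
  lin l (\sum_(i <- r | Q i) F i) = \sum_(i <- r | Q i) lin l (F i).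
Proof. by apply: big_morph; [exact: linD|exact: lin0]. Qed.

(** [phi] is the symbol of a degree 0 operator; these symbols are the polynomial
functions on the lattice. *)
Definition diagonal phi :=
  exists2 P, diffop_torus P & forall c, lend_fun P (mono c) = phi c *: mono c.

Lemma diagonal_const k : diagonal (fun=> k).
Proof. by exists (scalar_op d k); first exact: diffop_scalar. Qed.

Lemma diagonalM phi psi : diagonal phi -> diagonal psi ->
  diagonal (fun c => phi c * psi c).
Proof.
move=> [P dP PE] [Q dQ QE]; exists (P * Q); first exact: diffop_mul.
by move=> c; rewrite lend_funM QE lend_funZ PE scalerA mulrC.
Qed.

(** The operator is [\sum_i l_i t_i d/dt_i - k]. *)
Lemma diagonal_affine l k : diagonal (fun c => lin l c - k).
Proof.
pose E := (\sum_(i < d) scalar_op d (l 0 i) *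
            (monomial_op K (delta_mx 0 i) * partial_op K i)).
have lE f (r : seq 'I_d) (F : 'I_d -> lend (laurent K d)) :
    lend_fun (\sum_(i <- r) F i) f = \sum_(i <- r) lend_fun (F i) f.
  by apply: (big_morph (fun P => lend_fun P f)).
exists (E + scalar_op d (- k)).
  apply: diffop_add; last exact: diffop_scalar.
  apply: diffop_sum => i; apply: diffop_mul; first exact: diffop_scalar.
  by apply: diffop_mul; [exact: diffop_monomial|exact: diffop_partial].
move=> c; rewrite lend_fun_addl scalerBl scalar_opE scaleNr; congr (_ - _).
rewrite lE scaler_suml; apply: eq_bigr => i _.
rewrite !lend_funM scalar_opE partial_opE lend_funZ monomial_opE.
by rewrite addrC subrK scalerA mulrC.
Qed.

(** [c] is outside the Zariski closure of [Z]. *)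
Definition separated c Z :=
  exists phi, [/\ diagonal phi, phi c != 0 & forall x, Z x -> phi x = 0].

Lemma separatedU c Z Z' : separated c Z -> separated c Z' ->
  separated c (Z `|` Z').
Proof.
move=> [phi [dphi phic phiZ]] [psi [dpsi psic psiZ]].
exists (fun x => phi x * psi x); split; first exact: diagonalM.
  by rewrite mulf_neq0.
by move=> x [/phiZ ->|/psiZ ->]; rewrite ?mul0r ?mulr0.
Qed.

Lemma separated_sub c Z Z' : Z `<=` Z' -> separated c Z' -> separated c Z.
Proof. by move=> ZZ' [phi [? ? phiZ]]; exists phi; split => // x /ZZ'/phiZ. Qed.

Lemma separated0 c : separated c set0.
Proof. by exists (fun=> 1); split=> //; [exact: diagonal_const|exact: oner_neq0]. Qed.

Lemma separated_bigcup (I : eqType) (r : seq I) c (Z : I -> set 'rV[int]_d) :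
  (forall i, i \in r -> separated c (Z i)) ->
  separated c (\bigcup_(i in [set` r]) Z i).
Proof.
elim: r => [|i r IH] sep.
  by apply: separated_sub (separated0 c) => x [].
apply: separated_sub (separatedU (sep i (mem_head _ _)) (IH _)).
  by move=> x [j /=]; rewrite inE => /orP[/eqP->|jr] Zx; [left|right; exists j].
by move=> j jr; apply: sep; rewrite inE jr orbT.
Qed.

Lemma separated_affine c l (k : K) Z : lin l c != k -> (forall x, Z x -> lin l x = k) ->
  separated c Z.
Proof.
move=> lc lZ; exists (fun x => lin l x - k); split.
- exact: diagonal_affine.
- by rewrite subr_eq0.
- by move=> x /lZ ->; rewrite subrr.
Qed.

Lemma laurent_on0 S : laurent_on S (0 : laurent K d).
Proof. by move=> a; rewrite msupp0. Qed.

Lemma laurent_onD S f g : laurent_on S f -> laurent_on S g -> laurent_on S (f + g).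
Proof.
move=> Sf Sg a /(fsubsetP (msuppD_le _ _)).
by rewrite in_fsetU => /orP[/Sf|/Sg].
Qed.

Lemma laurent_onZ S k f : laurent_on S f -> laurent_on S (k *: f).
Proof. by move=> Sf a /(fsubsetP (msuppZ_le _ _))/Sf. Qed.

Lemma laurent_on_mono S a : laurent_on S (mono a) <-> S a.
Proof.
rewrite /laurent_on /= /monomial; split=> [|Sa c]; rewrite msuppU oner_eq0.
  by apply; rewrite in_fset1.
by rewrite in_fset1 => /eqP ->.
Qed.

Lemma laurent_on_stable S P :
  (forall a, S a -> laurent_on S (lend_fun P (mono a))) ->
  forall f, laurent_on S f -> laurent_on S (lend_fun P f).
Proof.
move=> SP f Sf; rewrite [f]laurent_expand lend_fun_sum big_seq_cond.
apply: (big_ind (@laurent_on K d S)); first exact: laurent_on0.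
  by move=> ? ?; exact: laurent_onD.
move=> a /andP[af _]; rewrite lend_funZ; apply: laurent_onZ; apply: SP; exact: Sf.
Qed.

(** [G] may annihilate [t^c] itself: it is enough that it does not annihilate
the other points of a half-line issued from [c]. *)
Lemma diagonal_cancel u P Q G phi c : [pchar K] =i pred0 ->
  diffop_torus P -> diffop_torus Q ->
  (forall x, lend_fun G (mono x) = phi x *: mono x) ->
  (forall s, phi (u *+ s.+1 + c) != 0) ->
  P * G = Q * G -> lend_fun P (mono c) = lend_fun Q (mono c).
Proof.
move=> ch dP dQ GE phi0 PQ; apply/eqP; rewrite -subr_eq0; apply/eqP.
have DE f : lend_fun P f - lend_fun Q f = lend_fun (P + scalar_op d (-1) * Q) f.
  by rewrite lend_fun_addl lend_funM scalar_opE scaleN1r.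
rewrite DE; apply: (diffop_eq0_on_line (u := u)) => //.
  by apply: diffop_add => //; apply: diffop_mul => //; exact: diffop_scalar.
move=> s; rewrite monomial_opE -DE; apply: (scalerI (phi0 s)).
by rewrite scaler0 scalerBr -!lend_funZ -!GE -!lend_funM PQ subrr.
Qed.

(** The chain consists of the left ideals of all [P G] in [D(S)] such that [P]
maps the monomials of exponents [p + j w], [j >= k], into [K[S]]. The line
through [p + k w] in direction [u] is what allows [P] to be recovered from
[P G], even though [phi] may vanish on the whole ray. *)
Lemma not_left_noetherian_of_ray S p w u (phi : 'rV[int]_d -> K) :
  [pchar K] =i pred0 ->
  ~ S p -> (forall n, S (p + w *+ n.+1)) ->
  diagonal phi -> (forall k s, phi (u *+ s.+1 + (p + w *+ k)) != 0) ->
  (forall k, separated (p + w *+ k)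
     [set x | [/\ S x, ~ S (x - w *+ k) & phi x != 0]]) ->
  ~ left_noetherian (diffop_ring K S).
Proof.
move=> ch Sp Sray [G dG GE] phi0 sep noeth.
pose I k : set (diffop_ring K S) := [set X : diffop_ring K S |
  exists P, [/\ diffop_torus P, diffop_val X = P * G &
    forall j, (k <= j)%N -> laurent_on S (lend_fun P (mono (p + w *+ j)))]].
have [||N IN] := noeth I.
- move=> k; split.
  + exists 0; split; [exact: diffop0|by rewrite mul0r|].
    by move=> j _; exact: laurent_on0.
  + move=> X Y [P [dP XE SP]] [Q [dQ YE SQ]]; exists (P + Q); split.
    * exact: diffop_add.
    * by rewrite mulrDl -XE -YE.
    * by move=> j kj; rewrite lend_fun_addl; apply: laurent_onD; [exact: SP|exact: SQ].
  + move=> [Y yP] X [P [dP XE SP]]; move/asboolP: (yP) => [dY SY].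
    exists (Y * P); split; first exact: diffop_mul.
      by rewrite -mulrA -XE.
    by move=> j kj; rewrite lend_funM; apply: SY; exact: SP.
- move=> k X [P [dP XE SP]]; exists P; split=> // j kj; apply: SP; exact: ltnW.
(* [X G] is in the ideal of index [N.+1] but not in that of index [N], since [X]
   moves the ray back by [N] steps and so maps its [N]-th point to [p]. *)
have [f [[F dF FE] fp fZ]] := sep N.
pose X := monomial_op K (- (w *+ N)) * F.
have XE x : lend_fun X (mono x) = f x *: mono (x - w *+ N).
  by rewrite lend_funM FE lend_funZ monomial_opE addrC.
have dX : diffop_torus X by apply: diffop_mul => //; exact: diffop_monomial.
have XG : diffop_pred S (X * G).
  apply/asboolP; split; first exact: diffop_mul.
  apply: laurent_on_stable => x Sx; rewrite lend_funM GE lend_funZ XE.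
  have [Sx'|nSx'] := pselect (S (x - w *+ N)).
    by do 2!apply: laurent_onZ; exact/laurent_on_mono.
  have [->|phix] := eqVneq (phi x) 0; first by rewrite scale0r; exact: laurent_on0.
  by rewrite fZ // scale0r scaler0; exact: laurent_on0.
have : I N.+1 (DiffOp XG).
  exists X; split=> // j Nj; rewrite XE; apply: laurent_onZ; apply/laurent_on_mono.
  rewrite -addrA -mulrnBr ?(ltnW Nj) //.
  by rewrite -(prednK (n := j - N)) ?subn_gt0.
rewrite IN // => -[P [dP /= PE /(_ N (leqnn _))]].
rewrite -(diagonal_cancel ch dX dP GE (phi0 N) PE) XE addrK => Sf.
apply: Sp; apply/laurent_on_mono.
by rewrite -[mono p](scalerK fp); exact: laurent_onZ.
Qed.

End DiagonalOperators.

(** * Separation by linear forms in characteristic 0 *)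

Section LinearForms.
Variable d : nat.

(** The form is a coordinate of the projection along [U]. *)
Lemma form_separates (L : fieldType) (U : {vspace 'rV[L]_d}) v : v \notin U ->
  exists l : 'rV[L]_d, (forall x, x \in U -> \sum_j x 0 j * l 0 j = 0) /\
    \sum_j v 0 j * l 0 j != 0.
Proof.
move=> vU; have [i vi] : exists i, (v - projv U v) 0 i != 0.
  apply/existsP; rewrite -negb_forall; apply: contra vU => /forallP v0.
  suff -> : v = projv U v by exact: memv_proj.
  by apply/eqP; rewrite -subr_eq0; apply/eqP/rowP => i; rewrite [RHS]mxE; exact/eqP.
pose l : 'rV[L]_d := \row_j (delta_mx 0 j - projv U (delta_mx 0 j)) 0 i.
have lE (x : 'rV[L]_d) : \sum_j x 0 j * l 0 j = (x - projv U x) 0 i.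
  rewrite {2 3}[x]row_sum_delta linear_sum -sumrB summxE; apply: eq_bigr => j _.
  by rewrite linearZ -scalerBr !mxE.
exists l; split=> [x xU|]; rewrite lE //.
by rewrite projv_id // subrr mxE.
Qed.

Lemma int_vecE (L : pzRingType) (a : 'rV[int]_d) j : int_vec L a 0 j = (a 0 j)%:~R.
Proof. by rewrite mxE. Qed.

Lemma linE (K : fieldType) (l : 'rV[K]_d) c :
  lin l c = \sum_j (int_vec K c) 0 j * l 0 j.
Proof. by apply: eq_bigr => j _; rewrite int_vecE. Qed.

Lemma pchar0_intr_eq0 (K : fieldType) (z : int) : [pchar K] =i pred0 ->
  ((z%:~R : K) == 0) = (z == 0).
Proof.
move=> /pcharf0P ch; case: z => n; first by rewrite -pmulrn ch.
by rewrite NegzE mulrNz oppr_eq0 -pmulrn ch.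
Qed.

(** Linear independence of integer vectors does not depend on the field of
characteristic 0: a separating form exists over the rationals, and clearing
denominators makes it integral, so that it makes sense over [K]. *)
Lemma lin_separates (R : realType) (K : fieldType) (X : seq 'rV[int]_d) v :
  [pchar K] =i pred0 ->
  int_vec R v \notin <<map (int_vec R) X>>%VS ->
  exists l : 'rV[K]_d, (forall x, x \in X -> lin l x = 0) /\ lin l v != 0.
Proof.
move=> ch vX.
have : int_vec rat v \notin <<map (int_vec rat) X>>%VS.
  apply: contra vX => /(coord_span (X := in_tuple _)) vE.
  have -> : int_vec R v = map_mx ratr (int_vec rat v).
    by apply/rowP => j; rewrite !mxE ratr_int.
  rewrite vE map_mx_sum memv_suml // => i _; rewrite map_mxZ memvZ //.
  rewrite -tnth_nth /= memv_span //.
  have /mapP[x xX ->] := mem_tnth i (in_tuple (map (int_vec rat) X)).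
  apply/mapP; exists x => //.
  by apply/rowP => j; rewrite !mxE ratr_int.
move=> /form_separates[l [lX lv]].
(* The integral form [n] is [l] multiplied by the product [D] of the denominators
   of its coefficients. *)
pose n j := numq (l 0 j) * \prod_(i | i != j) denq (l 0 i).
pose D := \prod_i denq (l 0 i).
have nE (x : 'rV[int]_d) : (\sum_j x 0 j * n j)%:~R =
    D%:~R * \sum_j (int_vec rat x) 0 j * l 0 j.
  rewrite rmorph_sum mulr_sumr; apply: eq_bigr => j _ /=.
  rewrite int_vecE /D (bigD1 j) // /n !intrM /=.
  rewrite -{3}[l 0 j]divq_num_den.
  have := denq_neq0 (l 0 j); rewrite -(intr_eq0 rat) => ?.
  by field.
exists (\row_j (n j)%:~R).
have lE x : lin (\row_j (n j)%:~R : 'rV[K]_d) x = (\sum_j x 0 j * n j)%:~R.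
  by rewrite rmorph_sum; apply: eq_bigr => j _; rewrite !mxE /= -intrM.
split=> [x xX|]; rewrite lE.
  apply/eqP; rewrite pchar0_intr_eq0 // -(intr_eq0 rat) nE lX ?mulr0 //.
  by apply: memv_span; exact: map_f.
rewrite pchar0_intr_eq0 // -(intr_eq0 rat) nE mulf_neq0 //.
rewrite intr_eq0 /D; apply/prodf_neq0 => i _; exact: denq_neq0.
Qed.
End LinearForms.

(** * Monoids, lattices and dimension *)

Section Monoids.
Variables (R : realType) (d : nat) (A : {fset 'rV[int]_d}).
Implicit Types (a x y : 'rV[int]_d) (tau : set 'rV[R]_d).

Local Notation S := (monoid_gen A).

Lemma monoid_gen0 : S 0.
Proof. by exists (fun=> 0%N); rewrite big1 // => a _; rewrite mulr0n. Qed.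

Lemma monoid_genD x y : S x -> S y -> S (x + y).
Proof.
move=> [c ->] [e ->]; exists (fun a => c a + e a)%N.
by rewrite -big_split; apply: eq_bigr => a _; rewrite mulrnDr.
Qed.

Lemma monoid_genMn x n : S x -> S (x *+ n).
Proof.
move=> Sx; elim: n => [|n IH]; first by rewrite mulr0n; exact: monoid_gen0.
by rewrite mulrS; exact: monoid_genD.
Qed.

Lemma monoid_gen_mem a : a \in A -> S a.
Proof.
move=> aA; exists (fun x => nat_of_bool (x == a)).
rewrite (big_fsetD1 a) //= eqxx mulr1n big_seq big1 ?addr0 // => x.
by rewrite !inE => /andP[/negPf -> _]; rewrite mulr0n.
Qed.

Lemma group_gen0 tau : group_gen A tau 0.
Proof. by exists (fun=> 0); rewrite big1 // => a _; rewrite mulr0z. Qed.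

Lemma group_genD tau x y : group_gen A tau x -> group_gen A tau y ->
  group_gen A tau (x + y).
Proof.
move=> [c ->] [e ->]; exists (fun a => c a + e a).
by rewrite -big_split; apply: eq_bigr => a _; rewrite mulrzDr.
Qed.

Lemma group_genN tau x : group_gen A tau x -> group_gen A tau (- x).
Proof.
move=> [c ->]; exists (fun a => - c a).
by rewrite -sumrN; apply: eq_bigr => a _; rewrite mulrNz.
Qed.

Lemma group_genB tau x y : group_gen A tau x -> group_gen A tau y ->
  group_gen A tau (x - y).
Proof. by move=> gx gy; apply: group_genD => //; exact: group_genN. Qed.

Lemma group_genMn tau x n : group_gen A tau x -> group_gen A tau (x *+ n).
Proof.
move=> gx; elim: n => [|n IH]; first by rewrite mulr0n; exact: group_gen0.
by rewrite mulrS; exact: group_genD.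
Qed.

Lemma group_gen_mem tau a : a \in A -> tau (int_vec R a) -> group_gen A tau a.
Proof.
move=> aA ta; exists (fun x => (x == a)%:Z).
rewrite big_mkcond (big_fsetD1 a) //= eqxx; case: asboolP => // _.
rewrite mulr1z big_seq big1 ?addr0 // => x.
by rewrite !inE => /andP[/negPf -> _]; rewrite mulr0z if_same.
Qed.

Lemma group_gen_sub tau tau' : tau `<=` tau' -> group_gen A tau `<=` group_gen A tau'.
Proof.
move=> tt' _ [c ->].
exists (fun a => if `[< tau (int_vec R a) >] then c a else 0).
rewrite big_mkcond [RHS]big_mkcond; apply: eq_bigr => a _.
case: asboolP => [/tt' ta|_]; first by case: asboolP.
by rewrite mulr0z if_same.
Qed.

Lemma lin_group_gen (K : fieldType) (l : 'rV[K]_d) tau x :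
  (forall a, a \in A -> tau (int_vec R a) -> lin l a = 0) ->
  group_gen A tau x -> lin l x = 0.
Proof.
move=> l0 [c ->]; rewrite lin_sum big_seq_cond big1 // => a /andP[aA /asboolP ta].
by rewrite linMz l0 // mul0rz.
Qed.

Lemma group_gen_sub_monoid x : group_gen A [set: 'rV[R]_d] x ->
  exists s s', [/\ S s, S s' & x = s - s'].
Proof.
move=> [c ->].
exists (\sum_(a <- A) a *+ (if c a is Posz n then n else 0%N)).
exists (\sum_(a <- A) a *+ (if c a is Negz n then n.+1 else 0%N)).
split; [by eexists|by eexists|].
rewrite -sumrB; apply: eq_big => a; first by apply/asboolP.
move=> _; case: (c a) => n; first by rewrite -pmulrn mulr0n subr0.
by rewrite NegzE mulrNz -pmulrn mulr0n sub0r.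
Qed.

End Monoids.

Section IntVec.
Variables (R : realType) (d : nat).
Local Notation iv := (@int_vec d R).

Lemma int_vecD a c : iv (a + c) = iv a + iv c.
Proof. by apply/rowP => j; rewrite !mxE rmorphD. Qed.

Lemma int_vec0 : iv 0 = 0.
Proof. by apply/rowP => j; rewrite !mxE. Qed.

Lemma int_vecN a : iv (- a) = - iv a.
Proof. by apply/rowP => j; rewrite !mxE rmorphN. Qed.

Lemma int_vecMn a n : iv (a *+ n) = iv a *+ n.
Proof. by elim: n => [|n IH]; rewrite ?mulr0n ?int_vec0 // !mulrS int_vecD IH. Qed.

Lemma int_vecMz a (z : int) : iv (a *~ z) = iv a *~ z.
Proof.
by case: z => n; rewrite ?NegzE ?mulrNz ?int_vecN -!pmulrn int_vecMn.
Qed.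

Lemma int_vec_sum (I : Type) (r : seq I) (Q : pred I) (F : I -> 'rV[int]_d) :
  iv (\sum_(i <- r | Q i) F i) = \sum_(i <- r | Q i) iv (F i).
Proof. by apply: big_morph; [exact: int_vecD|exact: int_vec0]. Qed.

Lemma form_span0 (F : {scalar 'rV[R]_d}) (X : seq 'rV[R]_d) v :
  (forall x, x \in X -> F x = 0) -> v \in <<X>>%VS -> F v = 0.
Proof.
move=> FX /(coord_span (X := in_tuple X)) ->; rewrite linear_sum big1 // => i _.
by rewrite linearZ /= FX ?mulr0 // mem_nth.
Qed.

Lemma free_subseq (X : seq 'rV[R]_d) :
  exists Y, [/\ {subset Y <= X}, free Y & <<Y>>%VS = <<X>>%VS].
Proof.
elim: X => [|v X [Y [YX fY sY]]]; first by exists [::]; split=> //; exact: nil_free.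
have [vY|vY] := boolP (v \in <<Y>>%VS).
  exists Y; split=> //; first by move=> y /YX; rewrite inE orbC => ->.
  by rewrite span_cons -sY; apply/esym/addv_idPr; rewrite -memvE.
exists (v :: Y); split.
- by move=> y; rewrite !inE => /orP[->//|/YX ->]; rewrite orbT.
- by rewrite free_cons vY.
- by rewrite !span_cons sY.
Qed.

Lemma dim_span_le (C : set 'rV[R]_d) (X : seq 'rV[R]_d) :
  (forall x, x \in X -> C x) -> (\dim <<X>> <= Defs.dim C)%N.
Proof.
move=> XC; have [Y [YX fY <-]] := free_subseq X.
have Yd : (size Y < d.+1)%N.
  rewrite ltnS -(eqP fY) (leq_trans (dimvS (subvf _))) //.
  by rewrite dimvf /dim /= mul1n.
rewrite (eqP fY); apply: (leq_bigmax_cond (Ordinal Yd)).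
by apply/asboolP; exists (in_tuple Y); split=> // v /YX/XC.
Qed.

Lemma dim_le (C : set 'rV[R]_d) (U : {vspace 'rV[R]_d}) :
  (forall v, C v -> v \in U) -> (Defs.dim C <= \dim U)%N.
Proof.
move=> CU; apply/bigmax_leqP => k /asboolP[B [/eqP fB BC]].
rewrite -{1}(size_tuple B) -fB; apply: dimvS.
by apply/span_subvP => v /BC/CU.
Qed.

End IntVec.

(** * Faces and facet forms of the cone *)

Section Faces.
Variables (R : realType) (d : nat) (A : {fset 'rV[int]_d}).
Implicit Types (a x y : 'rV[int]_d) (tau sigma : set 'rV[R]_d).

Local Notation S := (monoid_gen A).
Local Notation C := (cone R A).
Local Notation iv := (@int_vec d R).
Local Notation gens tau := [seq a <- A | `[< tau (iv a) >]].

Lemma monoid_gen_cone x : S x -> C (iv x).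
Proof.
move=> [c ->]; exists (fun a => (c a)%:R); first by move=> a; rewrite ler0n.
by rewrite int_vec_sum; apply: eq_bigr => a _; rewrite int_vecMn scaler_nat.
Qed.

Lemma cone_mem a : a \in A -> C (iv a).
Proof. by move=> aA; apply/monoid_gen_cone/monoid_gen_mem. Qed.

Lemma face_of_sub (E tau : set 'rV[R]_d) : face_of E tau -> tau `<=` E.
Proof. by move=> [F _ ->] v []. Qed.

Lemma subset_face tau tau' : face_of C tau -> tau' `<=` C -> tau `<=` tau' ->
  face_of tau' tau.
Proof.
move=> [F F0 ->] tC tt; exists F; first by move=> v /tC/F0.
by apply/seteqP; split=> v /= [Cv Fv]; split=> //; [exact: tt|exact: tC].
Qed.

(** A sum of nonnegative numbers is 0 only if all of them are. *)
Lemma face_of_comb tau (c : 'rV[int]_d -> R) : face_of C tau ->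
  (forall a, 0 <= c a) -> tau (\sum_(a <- A) c a *: iv a) ->
  forall a, a \in A -> 0 < c a -> tau (iv a).
Proof.
move=> [F F0 ->] c0 [_] /eqP; rewrite linear_sum /= => Fs a aA ca.
split; first exact: cone_mem.
move: Fs; rewrite big_seq psumr_eq0; last first.
  by move=> x xA; rewrite linearZ /= mulr_ge0 ?c0 ?F0 //; exact: cone_mem.
move=> /allP /(_ a aA); rewrite aA linearZ /= mulf_eq0 gt_eqF //=.
exact: eqP.
Qed.

Lemma face_of_span tau v : face_of C tau -> tau v ->
  v \in <<map iv (gens tau)>>%VS.
Proof.
move=> ft tv; have [c c0 vE] := face_of_sub ft tv.
rewrite vE in tv *; rewrite big_seq memv_suml // => a aA.
have [->|ca] := eqVneq (c a) 0; first by rewrite scale0r mem0v.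
rewrite memvZ // memv_span // map_f // mem_filter aA andbT; apply/asboolP.
by apply: (face_of_comb ft c0 tv aA); rewrite lt_def ca c0.
Qed.

Lemma dim_face tau : face_of C tau ->
  Defs.dim tau = \dim <<map iv (gens tau)>>.
Proof.
move=> ft; apply/eqP; rewrite eqn_leq dim_le /=; last by move=> v; exact: face_of_span.
by apply: dim_span_le => _ /mapP[a + ->]; rewrite mem_filter => /andP[/asboolP].
Qed.

Lemma face_of_cone : face_of C C.
Proof.
exists (\0 : {scalar 'rV[R]_d}) => // .
by apply/seteqP; split=> v // [].
Qed.

Hypothesis ZA_full : group_gen A [set: 'rV[R]_d] = [set: 'rV[int]_d].

Lemma dim_cone : Defs.dim C = d.
Proof.
apply/eqP; rewrite eqn_leq; apply/andP; split.
  rewrite (leq_trans (dim_le (U := fullv) _)) //; first by move=> v _; rewrite memvf.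
  by rewrite dimvf /dim /= mul1n.
rewrite dim_face; last exact: face_of_cone.
rewrite -{1}[d]mul1n -/(dim 'rV[R]_d) -dimvf; apply: dimvS.
apply/subvP => v _; rewrite [v]row_sum_delta memv_suml // => j _; rewrite memvZ //.
have -> : delta_mx 0 j = iv (delta_mx 0 j).
  by apply/rowP => k; rewrite !mxE rmorph_nat.
have [c ->] : group_gen A [set: 'rV[R]_d] (delta_mx 0 j) by rewrite ZA_full.
rewrite int_vec_sum big_seq_cond memv_suml // => a /andP[aA _].
rewrite int_vecMz -scaler_int memvZ // memv_span // map_f // mem_filter aA andbT.
by apply/asboolP; exact: cone_mem.
Qed.

Lemma primitive_form_int sigma F : primitive_form A sigma F ->
  forall x, exists z : int, F (iv x) = z%:~R.
Proof.
move=> [_ _ Fim] x; have : [set F (iv a) | a in [set: 'rV[int]_d]] (F (iv x)).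
  by exists x.
by rewrite Fim => -[z _ <-]; exists z.
Qed.

Lemma primitive_form_surj sigma F : primitive_form A sigma F ->
  forall z : int, exists x, F (iv x) = z%:~R.
Proof.
move=> [_ _ Fim] z; have : [set k%:~R | k in [set: int]] (z%:~R : R) by exists z.
by rewrite -Fim => -[x _ <-]; exists x.
Qed.

Lemma primitive_form_nat sigma F : primitive_form A sigma F ->
  forall x, S x -> exists n : nat, F (iv x) = n%:R.
Proof.
move=> pF x Sx; have [z zE] := primitive_form_int pF x.
have [F0 _ _] := pF; have := F0 _ (monoid_gen_cone Sx).
rewrite zE ler0z; case: z zE => // n nE _; by exists n.
Qed.

Lemma form_face0 tau (F : {scalar 'rV[R]_d}) : (forall v, tau v -> F v = 0) ->
  forall v, v \in <<map iv (gens tau)>>%VS -> F v = 0.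
Proof.
move=> F0 v; apply: form_span0 => _ /mapP[a + ->].
by rewrite mem_filter => /andP[/asboolP ta _]; exact: F0.
Qed.

(** Both forms vanish on the hyperplane spanned by the facet. As proportional
forms define the same condition on the scored closure, only finitely many forms
matter, one for each subset of [A]. *)
Lemma facet_form_proportional sigma sigma' F F' :
  facet_of C sigma -> facet_of C sigma' ->
  primitive_form A sigma F -> primitive_form A sigma' F' ->
  (forall a, a \in A -> sigma (iv a) <-> sigma' (iv a)) ->
  exists2 k : R, k != 0 & forall v, F' v = k * F v.
Proof.
move=> [fs ds] [fs' ds'] pF pF' same.
have [[_ Fs _] [_ Fs' _]] := (pF, pF').
have gE : gens sigma' = gens sigma.
  by apply: eq_in_filter => a /same[h1 h2]; apply/asboolP/asboolP.
have := form_face0 Fs'; rewrite gE => {}Fs'; move: (form_face0 Fs) => {}Fs.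
move: ds; rewrite dim_cone dim_face //; set U := <<_>>%VS in Fs Fs' *; move=> dU.
have [z Fz] := primitive_form_surj pF 1.
have zU : iv z \notin U by apply/negP => /Fs; rewrite Fz => /eqP; rewrite oner_eq0.
have UT : (U + <[iv z]>)%VS = fullv.
  apply/eqP; rewrite eqEdim subvf dimvf /dim /= mul1n.
  rewrite -[X in (X <= _)%N]dU.
  rewrite dimv_disjoint_sum; last first.
    apply/eqP; rewrite -subv0; apply/subvP => v; rewrite memv_cap => /andP[vU].
    move=> /vlineP[k vk]; rewrite vk in vU *; have := Fs _ vU.
    by rewrite linearZ /= Fz mulr1 => ->; rewrite scale0r mem0v.
  rewrite dim_vline -addn1 leq_add2l; case: eqP => // z0.
  by rewrite z0 mem0v in zU.
have FE v : F' v = F' (iv z) * F v.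
  have : v \in (U + <[iv z]>)%VS by rewrite UT memvf.
  move=> /memv_addP[u uU [_ /vlineP[k ->] ->]].
  rewrite !linearD !linearZ /= Fs // Fs' // Fz !add0r mulr1; exact: mulrC.
exists (F' (iv z)) => //.
have [z' Fz'] := primitive_form_surj pF' 1.
by apply/eqP => k0; move: Fz'; rewrite FE k0 mul0r => /eqP; rewrite eq_sym oner_eq0.
Qed.

(** The values of [F] on the monoid include two consecutive integers [q] and
[q + 1], which generate all the integers from [q * q] on. *)
Lemma primitive_form_cofinite sigma F : primitive_form A sigma F ->
  exists M : nat, forall n, (M <= n)%N -> exists2 s, S s & F (iv s) = n%:R.
Proof.
move=> pF; have [z Fz] := primitive_form_surj pF 1.
have : group_gen A [set: 'rV[R]_d] z by rewrite ZA_full.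
move=> /group_gen_sub_monoid[s [s' [Ss Ss' zE]]].
have [q Fs'] := primitive_form_nat pF Ss'.
have Fs : F (iv s) = q.+1%:R.
  have -> : s = z + s' by rewrite zE subrK.
  by rewrite int_vecD linearD Fz Fs' /= -natr1 addrC.
have FMn x n : F (iv (x *+ n)) = F (iv x) *+ n by rewrite int_vecMn linearMn.
have [q0|q0] := posnP q.
  exists 0%N => n _; exists (s *+ n); first exact: monoid_genMn.
  by rewrite FMn Fs q0.
exists (q * q)%N => n qn.
have qr : (n %% q <= n %/ q)%N.
  by rewrite (leq_trans (ltnW (ltn_pmod _ q0))) // leq_divRL.
(* For [n = u q + r], [n = (u - r) q + r (q + 1)]. *)
exists (s' *+ (n %/ q - n %% q) + s *+ (n %% q)).
  by apply: monoid_genD; exact: monoid_genMn.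
rewrite int_vecD linearD !FMn Fs Fs' -!mulrnA -natrD /=; congr _%:R.
rewrite {4}(divn_eq n q); nia.
Qed.

Lemma primitive_form_lin (K : fieldType) sigma F : primitive_form A sigma F ->
  exists l : 'rV[K]_d, forall x (z : int), F (iv x) = z%:~R -> lin l x = z%:~R.
Proof.
move=> pF; have /choice[n nE] : forall j : 'I_d, exists z : int,
    F (iv (delta_mx 0 j)) = z%:~R by move=> j; exact: primitive_form_int pF _.
exists (\row_j (n j)%:~R) => x z.
have -> : F (iv x) = (\sum_j x 0 j * n j)%:~R.
  rewrite {1}[x]row_sum_delta int_vec_sum linear_sum rmorph_sum.
  apply: eq_bigr => j _ /=; rewrite -[x 0 j in LHS]intz scaler_int.
  by rewrite int_vecMz raddfMz /= nE intrM mulrzl.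
move=> /eqP; rewrite eqr_int => /eqP <-; rewrite rmorph_sum.
by apply: eq_bigr => j _; rewrite !mxE /= intrM.
Qed.

End Faces.

(** * The scored closure and the choice of the ray *)

Section Geometry.
Variables (R : realType) (K : fieldType) (d : nat) (A : {fset 'rV[int]_d}).
Hypothesis charK : [pchar K] =i pred0.
Hypothesis ZA_full : group_gen A [set: 'rV[R]_d] = [set: 'rV[int]_d].
Implicit Types (a x y p w : 'rV[int]_d) (tau sigma : set 'rV[R]_d).

Local Notation S := (monoid_gen A).
Local Notation Sc := (scored_closure R A).
Local Notation C := (cone R A).
Local Notation iv := (@int_vec d R).

Lemma scored_closureD x s : Sc x -> S s -> Sc (x + s).
Proof.
move=> Sx Ss sigma F fs pF; have [t St FE] := Sx sigma F fs pF.
exists (t + s); first exact: monoid_genD.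
by rewrite !int_vecD !linearD /= FE.
Qed.

Lemma pchar0_natr_inj m n : (m%:R == n%:R :> K) = (m == n).
Proof.
rewrite -subr_eq0 !pmulrn -rmorphB /= pchar0_intr_eq0 // subr_eq0.
by [].
Qed.

(** Let [h = F (k w)]. At the points [x] of the set, [F x - h] is not a value of
[F] on the monoid, so [F x] is one of finitely many exceptional integers; [F]
differs from all of them at [p + k w], because [F (p + k w) - h = F p]. *)
Lemma separated_facet sigma F p w k : primitive_form A sigma F ->
  S w -> (exists2 s, S s & F (iv p) = F (iv s)) ->
  @separated K d (p + w *+ k)
    [set x | S x /\ ~ exists2 s, S s & F (iv (x - w *+ k)) = F (iv s)].
Proof.
move=> pF Sw [s Ss Fp]; have [l lE] := primitive_form_lin K pF.
have [M FM] := primitive_form_cofinite ZA_full pF.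
have [h hE] := primitive_form_nat pF (monoid_genMn k Sw).
have [q qE] := primitive_form_nat pF Ss.
pose bad v := `[< ~ exists2 s, S s & v%:R - h%:R = F (iv s) >].
apply: separated_sub (separated_bigcup (r := [seq v <- iota 0 (M + h) | bad v])
  (Z := fun v => [set x | lin l x = v%:R]) _) => [x [Sx nS]|v].
  have [v vE] := primitive_form_nat pF Sx.
  have xE : F (iv (x - w *+ k)) = v%:R - h%:R.
    by rewrite int_vecD int_vecN linearB /= vE hE.
  exists v; last by rewrite /= (lE _ v).
  rewrite /= mem_filter mem_iota add0n /=; apply/andP; split.
    by apply/asboolP; rewrite -xE.
  rewrite ltnNge; apply/negP => Mv; apply: nS.
  have [|t St tE] := FM (v - h)%N; first by lia.
  by exists t => //; rewrite xE tE natrB //; lia.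
rewrite mem_filter => /andP[/asboolP nv _].
apply: (separated_affine (l := l) (k := v%:R)) => [|//].
rewrite (lE _ (q + h)%N) ?int_vecD ?linearD /= ?hE ?Fp ?qE -?natrD //.
rewrite -pmulrn pchar0_natr_inj; apply/eqP => vE; apply: nv.
by exists s => //; rewrite qE -vE natrD addrK.
Qed.

(** Outside the scored closure means failing the condition of some facet. The
facets are grouped by the subset [B] of [A] they contain, which determines the
form up to a factor. *)
Lemma separated_scored p w k : S w -> Sc p ->
  @separated K d (p + w *+ k) [set x | S x /\ ~ Sc (x - w *+ k)].
Proof.
move=> Sw Sp.
pose on sigma (B : {fset 'rV[int]_d}) :=
  forall a, a \in A -> sigma (iv a) <-> a \in B.
pose Z B := [set x | S x /\ exists sigma (F : {scalar 'rV[R]_d}),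
  [/\ facet_of C sigma, primitive_form A sigma F, on sigma B &
      ~ exists2 s, S s & F (iv (x - w *+ k)) = F (iv s)]].
apply: separated_sub (separated_bigcup (r := enum_fset (fpowerset A))
  (Z := Z) _) => [x [Sx nSc]|B _].
  have [sigma [F [fs pF nF]]] : exists sigma (F : {scalar 'rV[R]_d}),
      [/\ facet_of C sigma, primitive_form A sigma F &
        ~ exists2 s, S s & F (iv (x - w *+ k)) = F (iv s)].
    apply: contrapT => none; apply: nSc => sigma F fs pF.
    by apply: contrapT => nF; apply: none; exists sigma, F.
  exists [fset a in A | `[< sigma (iv a) >]]%fset.
    rewrite /= fpowersetE; apply/fsubsetP => a; by rewrite !inE => /andP[].
  split=> //; exists sigma, F; split=> // a aA.
  by rewrite !inE aA; split=> /asboolP.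
have [[sigma [F [fs pF oB]]]|none] := pselect (exists sigma (F : {scalar 'rV[R]_d}),
    [/\ facet_of C sigma, primitive_form A sigma F & on sigma B]).
  apply: separated_sub (separated_facet k pF Sw (Sp _ _ fs pF)).
  move=> x [Sx [sigma' [F' [fs' pF' oB' nF']]]]; split=> // -[s Ss Fs].
  have [c _ cE] : exists2 c : R, c != 0 & forall v, F' v = c * F v.
    apply: (facet_form_proportional ZA_full fs fs' pF pF').
    by move=> a aA; rewrite oB // oB'.
  by apply: nF'; exists s => //; rewrite !cE Fs.
apply: separated_sub (separated0 _ _) => x [_ [sigma [F [fs pF oB _]]]].
by apply: none; exists sigma, F.
Qed.

(** The supporting form of the face is positive at [x] but only real; it shows
that [x] is not in the real span of the face. *)
Lemma lin_separates_face tau x : face_of C tau -> S x -> ~ tau (iv x) ->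
  exists l : 'rV[K]_d, (forall a, a \in A -> tau (iv a) -> lin l a = 0) /\
    lin l x != 0.
Proof.
move=> ft Sx tx; have [F F0 tauE] := ft.
have [||l [l0 lx]] := @lin_separates d R K [seq a <- A | `[< tau (iv a) >]] x.
- exact: charK.
- apply/negP => /(form_face0 (F := F)) Fx; apply: tx; rewrite tauE.
  split; first exact: monoid_gen_cone.
  by apply: Fx => v; rewrite tauE => -[].
exists l; split=> // a aA ta; apply: l0; rewrite mem_filter aA andbT; exact/asboolP.
Qed.

(** The face and [w] together span a proper subspace. *)
Lemma lin_vanishing tau w : face_of C tau -> (1 < codim tau)%N ->
  exists l : 'rV[K]_d, [/\ forall a, a \in A -> tau (iv a) -> lin l a = 0,
    lin l w = 0 & exists u, lin l u != 0].
Proof.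
move=> ft cd; set G := [seq a <- A | `[< tau (iv a) >]].
have [j jG] : exists j, iv (delta_mx 0 j) \notin <<map iv (w :: G)>>%VS.
  apply/existsP; rewrite -negb_forall; apply/negP => /forallP all_in.
  have : (\dim (fullv : {vspace 'rV[R]_d}) <= \dim <<map iv (w :: G)>>)%N.
    apply: dimvS; apply/subvP => v _.
    rewrite [v]row_sum_delta memv_suml // => j _; rewrite memvZ //.
    rewrite (_ : delta_mx 0 j = iv (delta_mx 0 j)) ?all_in //.
    by apply/rowP => k; rewrite !mxE rmorph_nat.
  rewrite dimvf /dim /= mul1n span_cons => /leq_trans/(_ (dimv_add_leqif _ _)).
  rewrite -dim_face // dim_vline; move: cd; rewrite /codim ltn_subRL addn1 => dt.
  apply/negP; rewrite -ltnNge; apply: leq_trans dt; rewrite ltnS.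
  by rewrite -[leqRHS]add1n leq_add2r leq_b1.
have [l [l0 lj]] := lin_separates charK jG.
exists l; split; last by exists (delta_mx 0 j).
- by move=> a aA ta; apply: l0; rewrite inE mem_filter aA (asboolT ta) orbT.
- by apply: l0; rewrite inE eqxx.
Qed.

Lemma group_cosetE x c tau : group_coset A c tau x <-> group_gen A tau (x - c).
Proof.
split=> [[y gy <-]|gx]; first by rewrite addrC addKr.
by exists (x - c) => //; rewrite addrC subrK.
Qed.

Lemma face_subset tau tau' : face_of C tau -> face_of C tau' ->
  (forall a, a \in A -> tau (iv a) -> tau' (iv a)) -> tau `<=` tau'.
Proof.
move=> ft ft' sub v tv; have Cv := face_of_sub ft tv.
have [F F0 tE] := ft'; have [c c0 vE] := Cv; rewrite tE; split=> //.
rewrite vE in tv *; rewrite linear_sum big_seq big1 // => a aA; rewrite linearZ /=.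
have [->|ca] := eqVneq (c a) 0; first by rewrite mul0r.
have : tau' (iv a).
  by apply: sub => //; apply: (face_of_comb ft c0 tv aA); rewrite lt_def ca c0.
by rewrite tE => -[_ ->]; rewrite mulr0.
Qed.

(** The witness is the sum of the elements of [A] on [tau], a point of its
relative interior. *)
Lemma face_interior_point tau : face_of C tau ->
  exists x, [/\ S x, group_gen A tau x &
    forall tau', face_of C tau' -> tau' (iv x) -> tau `<=` tau'].
Proof.
move=> ft; exists (\sum_(a <- A | `[< tau (iv a) >]) a); split.
- exists (fun a => nat_of_bool `[< tau (iv a) >]).
  by rewrite big_mkcond; apply: eq_bigr => a _; case: asboolP.
- by exists (fun=> 1).
move=> tau' ft' tx; apply: face_subset => // a aA ta.
pose c (a : 'rV[int]_d) : R := if `[< tau (iv a) >] then 1 else 0.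
have xE : iv (\sum_(a <- A | `[< tau (iv a) >]) a) = \sum_(a <- A) c a *: iv a.
  rewrite int_vec_sum big_mkcond; apply: eq_bigr => e _.
  by rewrite /c; case: asboolP; rewrite ?scale1r ?scale0r.
rewrite xE in tx; apply: (face_of_comb ft' _ tx aA).
  by move=> e; rewrite /c; case: ifP.
by rewrite /c (asboolT ta) ltr01.
Qed.

(** Among the generators that occur in [v], one is outside [tau]; all of them
lie on every face through [v]. *)
Lemma generator_outside_face tau v : face_of C tau -> C v -> ~ tau v ->
  exists a, [/\ a \in A, ~ tau (iv a) &
    forall tau', face_of C tau' -> tau' v -> tau' (iv a)].
Proof.
move=> ft Cv; have [c c0 vE] := Cv; rewrite vE in Cv *; move=> tv.
have [a [aA ca ta]] : exists a, [/\ a \in A, 0 < c a & ~ tau (iv a)].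
  apply: contrapT => none; apply: tv.
  have [F F0 tE] := ft; rewrite tE; split; first by exists c.
  rewrite linear_sum big_seq big1 // => a aA; rewrite linearZ /=.
  have [->|ca] := eqVneq (c a) 0; first by rewrite mul0r.
  suff : tau (iv a) by rewrite tE => -[_ ->]; rewrite mulr0.
  apply: contrapT => ta; apply: none; exists a; split=> //.
  by rewrite lt_def ca c0.
by exists a; split=> // tau' ft' t'v; apply: (face_of_comb ft' c0 t'v aA ca).
Qed.

Lemma finitely_many_exceptions (I : finType) (bad : I -> nat -> Prop) :
  (forall i n n', bad i n -> bad i n' -> n = n') ->
  exists N, forall n, (N <= n)%N -> forall i, ~ bad i n.
Proof.
move=> uniq_bad.
have /choice[N NE] : forall i, exists N, forall n, (N <= n)%N -> ~ bad i n.
  move=> i; have [[n bn]|none] := pselect (exists n, bad i n).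
    by exists n.+1 => n' nn' /(uniq_bad _ _ _ bn) nE; rewrite nE ltnn in nn'.
  by exists 0%N => n _ bn; apply: none; exists n.
exists (\max_i N i)%N => n Nn i; apply: NE; apply: leq_trans Nn.
exact: leq_bigmax.
Qed.

Lemma lin_ray_inj (l : 'rV[K]_d) x y n n' : lin l y != 0 ->
  lin l (x + y *+ n) = lin l (x + y *+ n') -> n = n'.
Proof.
move=> ly; rewrite !linD !linMn => /addrI.
rewrite -[_ *+ n]mulr_natr -[_ *+ n']mulr_natr => /(mulfI ly)/eqP.
by rewrite pchar0_natr_inj => /eqP.
Qed.

End Geometry.

Theorem theorem7p8 (R : realType) (K : closedFieldType)
    (charK : [pchar K] =i pred0)
    (d : nat) (A : {fset 'rV[int]_d})
    (ZA_full : group_gen A [set: 'rV[R]_d] = [set: 'rV[int]_d])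
    (A_pointed : strongly_convex (cone R A))
    (m : nat) (b : 'I_m.+1 -> 'rV[int]_d) (tau : 'I_m.+1 -> set 'rV[R]_d)
    (S_std : standard_expression A b tau)
    (codim_tau : (1 < codim (tau ord_max))%N)
    (tau_inter :
      cone R A `&`
        \bigcap_(i in [set i : 'I_m.+1 |
            [/\ face_of (tau i) (tau ord_max),
                tau i <> tau ord_max &
                int_vec K (b i - b ord_max) \in span_over K A (tau i)]])
          tau i
      <> tau ord_max) :
  ~ left_noetherian (diffop_ring K (monoid_gen A)).
Proof.
have [_ ft SE irr] := S_std.
set t := tau ord_max; set S := monoid_gen A.
pose co i := group_coset A (b i) (tau i).
have S_co x i : S x -> ~ co i x.
  by rewrite /S SE => -[_ nco] cx; apply: nco; exists i.
have S_of x : scored_closure R A x -> (forall i, ~ co i x) -> S x.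
  by move=> Sx nco; rewrite /S SE; split=> // -[i _ /nco].
(* Irredundancy: the coset of index [ord_max] removes a point that no other coset
   removes. *)
have [q [Sq nSq nco]] : exists q, [/\ scored_closure R A q, ~ S q &
    forall i, i != ord_max -> ~ co i q].
  apply: contrapT => none; apply: (irr ord_max); apply/seteqP; split.
    move=> x Sx; split; first by move: Sx; rewrite SE => -[].
    by move=> [i _ /S_co]; apply.
  move=> x [Sx nx]; apply: contrapT => nSx; apply: none; exists x; split=> //.
  by move=> i im cx; apply: nx; exists i.
have qb : group_gen A t (q - b ord_max).
  apply/group_cosetE; apply: contrapT => ncoq; apply/nSq/S_of => // i.
  by have [->|/nco] := eqVneq i ord_max.
have tC : t `<=` cone R A := face_of_sub (ft ord_max).
pose J i := [/\ face_of (tau i) t, tau i <> t &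
  int_vec K (b i - b ord_max) \in span_over K A (tau i)].
have [w [wA wt wJ]] : exists w, [/\ w \in A, ~ t (int_vec R w) &
    forall i, J i -> tau i (int_vec R w)].
  have [v [[Cv Jv] tv]] : exists v, (cone R A `&` \bigcap_(i in J) tau i) v /\ ~ t v.
    apply: contrapT => none; apply: tau_inter; apply/seteqP; split=> v.
      by move=> Jv; apply: contrapT => tv; apply: none; exists v.
    move=> tv; split; first exact: tC.
    by move=> i [/face_of_sub-fi _ _]; apply: fi.
  have [a [aA ta av]] := generator_outside_face (ft ord_max) Cv tv.
  by exists a; split=> // i Ji; apply: av => //; exact: Jv.
have Sw : S w := monoid_gen_mem wA.
(* Adding a large multiple of an interior point of [t] to [q] separates it from
   [b i] for all the faces [tau i] that do not contain [t]. *)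
have [x0 [Sx0 x0t x0i]] := face_interior_point (ft ord_max).
have [N Nx0] : exists N, forall n, (N <= n)%N -> forall i,
    ~ (~ t `<=` tau i /\ forall l : 'rV[K]_d,
        (forall a, a \in A -> tau i (int_vec R a) -> lin l a = 0) ->
        lin l (q - b i + x0 *+ n) = 0).
  apply: finitely_many_exceptions => i n n' [nti ln] [_ ln'].
  have nti0 : ~ tau i (int_vec R x0) by move=> /(x0i _ (ft i)).
  have [l [l0 lx]] := lin_separates_face charK (ft i) Sx0 nti0.
  by apply: (lin_ray_inj charK (x := q - b i) lx); rewrite ln // ln'.
pose p := q + x0 *+ N.
have Sp : scored_closure R A p by apply: scored_closureD => //; exact: monoid_genMn.
have pb : group_gen A t (p - b ord_max).
  by rewrite /p addrAC; apply: group_genD => //; exact: group_genMn.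
have nSp : ~ S p.
  by move=> Sp'; apply: (S_co p ord_max Sp'); apply/group_cosetE.
pose forms i (l : 'rV[K]_d) :=
  forall a, a \in A -> tau i (int_vec R a) -> lin l a = 0.
(* The second alternative serves the faces of the hypothesis on the intersection;
   for the others, a form separates unless [tau i = t]. *)
have tricho i : [\/ exists2 l, forms i l & lin l (p - b i) != 0,
    tau i (int_vec R w) /\ ~ co i p |
    tau i = t /\ forall l, forms ord_max l -> lin l (p - b i) = 0].
  have [sep|nsep] := pselect (exists2 l, forms i l & lin l (p - b i) != 0).
    exact: Or31.
  have l0 l : forms i l -> lin l (p - b i) = 0.
    by move=> fl; apply/eqP/negPn/negP => lp; apply: nsep; exists l.
  have [tit|tit] := pselect (tau i = t).
    by apply: Or33; split=> // l fl; apply: l0; rewrite /forms tit.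
  have ti : t `<=` tau i.
    apply: contrapT => nti; apply: (Nx0 N (leqnn _) i); split=> // l fl.
    by rewrite addrAC; exact: l0.
  have Ji : J i.
    split=> //; first exact: (subset_face (ft ord_max) (face_of_sub (ft i)) ti).
    apply/negPn/negP => /form_separates[l [lU lb]].
    have fl : forms i l.
      move=> a aA ta; rewrite linE; apply: lU; apply: memv_span; apply: map_f.
      by rewrite mem_filter aA andbT; exact/asboolP.
    move/eqP: lb; apply; rewrite -linE.
    have -> : b i - b ord_max = (p - b ord_max) - (p - b i).
      by rewrite opprB [RHS]addrC addrA subrK.
    rewrite linB l0 // subr0; apply: lin_group_gen pb => a aA ta.
    by apply: fl => //; exact: ti.
  apply: Or32; split; first exact: wJ.
  have im : i != ord_max by apply/eqP => im; apply: tit; rewrite im.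
  move=> /group_cosetE pi; apply: (nco i im); apply/group_cosetE.
  have -> : q - b i = (p - b i) - x0 *+ N.
    by rewrite /p [q + _ - b i]addrAC addrK.
  by apply: group_genB => //; apply: group_genMn; exact: group_gen_sub x0t.
have wi_co i n x : tau i (int_vec R w) -> co i (x + w *+ n) -> co i x.
  move=> wi /group_cosetE; rewrite addrAC => xi; apply/group_cosetE.
  rewrite -[x - b i](addrK (w *+ n)); apply: group_genB => //.
  by apply: group_genMn; exact: group_gen_mem.
have lin_co i l x : forms i l -> co i x -> lin l x = lin l (b i).
  move=> fl /group_cosetE xi; apply/eqP; rewrite -subr_eq0 -linB.
  by apply/eqP; apply: lin_group_gen xi.
(* The points [p + n w] leave all the cosets for good, as each coset contains at
   most one of them. *)
have [M Mray] : exists M, forall n, (M <= n)%N -> forall i, ~ co i (p + w *+ n).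
  apply: finitely_many_exceptions => i n n' cn cn'.
  have [[l fl lp]|[wi pi]|[tit l0]] := tricho i.
  - have lw : lin l w != 0.
      apply/eqP => lw; move/eqP: lp; apply.
      by rewrite linB -(lin_co _ _ _ fl cn) linD linMn lw mul0rn addr0 subrr.
    by apply: (lin_ray_inj charK (x := p) lw); rewrite !(lin_co i l).
  - by case: pi; exact: wi_co cn.
  - have [l [fl lw]] := lin_separates_face charK (ft ord_max) Sw wt.
    have fl' : forms i l by rewrite /forms tit.
    by apply: (lin_ray_inj charK (x := p) lw); rewrite !(lin_co i l).
pose w' := w *+ M.+1.
have Sw' : S w' by exact: monoid_genMn.
have [l0 [fl0 l0w [u l0u]]] := lin_vanishing charK w (ft ord_max) codim_tau.
apply: (@not_left_noetherian_of_ray K d S p w' u (fun x => lin l0 x - lin l0 p)) => //.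
- move=> n; rewrite -mulrnA; apply: S_of; last by apply: Mray; lia.
  by apply: scored_closureD => //; exact: monoid_genMn.
- exact: diagonal_affine.
- move=> k s; rewrite !linD !linMn l0w !mul0rn addr0 addrK.
  by rewrite -mulr_natr mulf_neq0 // (pchar0_natr_inj charK _ 0).
move=> k.
pose al i := `[< exists2 l, forms i l & lin l (p - b i) != 0 >].
apply: separated_sub (separatedU (separated_scored charK ZA_full k Sw' Sp)
  (separated_bigcup (r := [seq i <- enum 'I_m.+1 | al i])
     (Z := fun i => [set x | co i (x - w' *+ k)]) _)).
  move=> x /= [Sx nSx phix].
  have [Scx|] := pselect (scored_closure R A (x - w' *+ k)); last by left.
  right; apply: contrapT => none; apply: nSx; apply: S_of => // i cx.
  have [al_i|[wi pi]|[tit l00]] := tricho i.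
  - apply: none; exists i => //=.
    by rewrite mem_filter mem_enum andbT; exact/asboolP.
  - apply: (S_co x i Sx); rewrite -(subrK (w' *+ k) x) in Sx *.
    apply/group_cosetE; rewrite addrAC; apply: group_genD.
      exact/group_cosetE.
    by apply: group_genMn; apply: group_genMn; exact: group_gen_mem.
  - have fl : forms i l0 by rewrite /forms tit.
    move/eqP: phix; apply; rewrite -(subrK (w' *+ k) x) linD.
    rewrite (lin_co _ _ _ fl cx) !linMn l0w !mul0rn addr0.
    by rewrite -linB -opprB linN l00 // oppr0.
move=> i; rewrite mem_filter => /andP[/asboolP[l fl lp] _].
apply: (separated_affine (l := l) (k := lin l (b i + w' *+ k))).
  by rewrite (linD l p) (linD l (b i)) (inj_eq (addIr _)) -subr_eq0 -linB.
move=> x cx.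
by rewrite [RHS]linD -(lin_co _ _ _ fl cx) -linD subrK.
Qed.
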